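(* Let $(A,\cdot,\alpha)$ be a Hom-algebra, and define $x\circ y=x\cdot y+y\cdot x$ for $x,y\in A$. Then $(A,\cdot,\alpha)$ is a Hom-pre-Jordan algebra if and only if $(A,\circ,\alpha)$ is a Hom-Jordan algebra and $(A,L,\alpha)$ is a representation of $(A,\circ,\alpha)$, where $L$ denotes the left multiplication operator, $L(x)(y)=x\cdot y$.
   Context: All vector spaces are over a field $\mathbb{K}$ of characteristic $0$. A Hom-algebra is a triple $(A,\mu,\alpha)$ with $A$ a vector space, $\mu$ a bilinear multiplication on $A$, and $\alpha:A\to A$ a linear map. A Hom-Jordan algebra is a Hom-algebra $(A,\circ,\alpha)$ such that, for all $x,y\in A$, $x\circ y=y\circ x$ and $as_\alpha(x\circ x,\alpha(y),\alpha(x))=0$, where $as_\alpha(a,b,c)=(a\circ b)\circ\alpha(c)-\alpha(a)\circ(b\circ c)$. A Hom-pre-Jordan algebra is a Hom-algebra $(A,\cdot,\alpha)$ such that, writing $x\circ y=x\cdot y+y\cdot x$, for all $x,y,z,u\in A$: $$[\alpha(x)\circ\alpha(y)]\cdot[\alpha(z)\cdot\alpha(u)]+[\alpha(y)\circ\alpha(z)]\cdot[\alpha(x)\cdot\alpha(u)]+[\alpha(z)\circ\alpha(x)]\cdot[\alpha(y)\cdot\alpha(u)]$$ $$=\alpha^2(x)\cdot[(y\circ z)\cdot\alpha(u)]+\alpha^2(y)\cdot[(z\circ x)\cdot\alpha(u)]+\alpha^2(z)\cdot[(x\circ y)\cdot\alpha(u)],$$ and $$[(x\circ z)\circ\alpha(y)]\cdot\alpha^2(u)+\alpha^2(x)\cdot[\alpha(y)\cdot(z\cdot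 u)]+\alpha^2(z)\cdot[\alpha(y)\cdot(x\cdot u)]$$ $$=\alpha^2(x)\cdot[(y\circ z)\cdot\alpha(u)]+\alpha^2(y)\cdot[(z\circ x)\cdot\alpha(u)]+\alpha^2(z)\cdot[(x\circ y)\cdot\alpha(u)].$$ A representation of a Hom-Jordan algebra $(A,\circ,\alpha)$ is a triple $(V,\rho,\phi)$ with $V$ a vector space, $\rho:A\to gl(V)$ linear ($gl(V)$ the linear endomorphisms of $V$) and $\phi:V\to V$ linear, such that for all $x,y,z\in A$: $$\phi\,\rho(x)=\rho(\alpha(x))\,\phi,$$ $$\rho(\alpha^2(x))\rho(y\circ z)\phi+\rho(\alpha^2(y))\rho(z\circ x)\phi+\rho(\alpha^2(z))\rho(x\circ y)\phi$$ $$=\rho(\alpha(x)\circ\alpha(y))\rho(\alpha(z))\phi+\rho(\alpha(y)\circ\alpha(z))\rho(\alpha(x))\phi+\rho(\alpha(z)\circ\alpha(x))\rho(\alpha(y))\phi,$$ $$\rho((x\circ y)\circ\alpha(z))\phi^2+\rho(\alpha^2(x))\rho(\alpha(z))\rho(y)+\rho(\alpha^2(y))\rho(\alpha(z))\rho(x)$$ $$=\rho(\alpha(x)\circ\alpha(y))\rho(\alpha(z))\phi+\rho(\alpha(y)\circ\alpha(z))\rho(\alpha(x))\phi+\rho(\alpha(z)\circ\alpha(x))\rho(\alpha(y))\phi.$$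
   Formalization: The formal theorem additionally assumes α(x·y)=α(x)·α(y); without it the claim fails (e·e=f, other products 0, α(e)=e, α(f)=0 is Hom-pre-Jordan, but L violates φρ(x)=ρ(α(x))φ). *)

(* Defs.v *)
From HB Require Import structures.
From mathcomp Require Import all_boot all_order all_algebra.

Set Implicit Arguments.
Unset Strict Implicit.
Unset Printing Implicit Defensive.

Import GRing.Theory.
Local Open Scope ring_scope.

Section HomAlgebras.

Variables (K : fieldType) (A : lmodType K).
Implicit Types (mu circ : {bilinear A -> A -> A}) (alpha : {linear A -> A}).

(* Compatibility of the twist with the product is not built into the notion of
   Hom-algebra, and does not follow from the Hom-pre-Jordan identities; it is
   what [phi rho(x) = rho(alpha x) phi] says for left multiplication. *)
Definition multiplicative_hom mu alpha : Prop :=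
  forall x y : A, alpha (mu x y) = mu (alpha x) (alpha y).

Definition anticommutator (mu : A -> A -> A) (x y : A) : A := mu x y + mu y x.

Definition hom_associator mu alpha (a b c : A) : A :=
  mu (mu a b) (alpha c) - mu (alpha a) (mu b c).

Definition is_hom_Jordan mu alpha : Prop :=
  (forall x y : A, mu x y = mu y x) /\
  (forall x y : A, hom_associator mu alpha (mu x x) (alpha y) (alpha x) = 0).

Definition is_hom_pre_Jordan mu alpha : Prop :=
  let o := anticommutator mu in
  (forall x y z u : A,
     mu (o (alpha x) (alpha y)) (mu (alpha z) (alpha u))
     + mu (o (alpha y) (alpha z)) (mu (alpha x) (alpha u))
     + mu (o (alpha z) (alpha x)) (mu (alpha y) (alpha u))
     = mu (alpha (alpha x)) (mu (o y z) (alpha u))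
       + mu (alpha (alpha y)) (mu (o z x) (alpha u))
       + mu (alpha (alpha z)) (mu (o x y) (alpha u))) /\
  (forall x y z u : A,
     mu (o (o x z) (alpha y)) (alpha (alpha u))
     + mu (alpha (alpha x)) (mu (alpha y) (mu z u))
     + mu (alpha (alpha z)) (mu (alpha y) (mu x u))
     = mu (alpha (alpha x)) (mu (o y z) (alpha u))
       + mu (alpha (alpha y)) (mu (o z x) (alpha u))
       + mu (alpha (alpha z)) (mu (o x y) (alpha u))).

(* [{linear V -> V}] plays the role of gl(V).  It carries no lmodType
   structure in the library, so linearity of [rho : A -> gl(V)] is the first
   clause; equalities in gl(V) are stated at each vector [v]. *)
Definition is_hom_Jordan_rep circ alpha (V : lmodType K)
    (rho : A -> {linear V -> V}) (phi : {linear V -> V}) : Prop :=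
  [/\ forall (a : K) (x y : A) (v : V),
        rho (a *: x + y) v = a *: rho x v + rho y v,
      forall (x : A) (v : V), phi (rho x v) = rho (alpha x) (phi v),
      forall (x y z : A) (v : V),
        rho (alpha (alpha x)) (rho (circ y z) (phi v))
        + rho (alpha (alpha y)) (rho (circ z x) (phi v))
        + rho (alpha (alpha z)) (rho (circ x y) (phi v))
        = rho (circ (alpha x) (alpha y)) (rho (alpha z) (phi v))
          + rho (circ (alpha y) (alpha z)) (rho (alpha x) (phi v))
          + rho (circ (alpha z) (alpha x)) (rho (alpha y) (phi v))
    & forall (x y z : A) (v : V),
        rho (circ (circ x y) (alpha z)) (phi (phi v))
        + rho (alpha (alpha x)) (rho (alpha z) (rho y v))
        + rho (alpha (alpha y)) (rho (alpha z) (rho x v))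
        = rho (circ (alpha x) (alpha y)) (rho (alpha z) (phi v))
          + rho (circ (alpha y) (alpha z)) (rho (alpha x) (phi v))
          + rho (circ (alpha z) (alpha x)) (rho (alpha y) (phi v))].

Definition left_mul mu (x : A) : {linear A -> A} := mu x.

End HomAlgebras.

Section AnticommutatorBilinear.

Variables (K : fieldType) (A : lmodType K) (mu : {bilinear A -> A -> A}).

Fact anticommutator_is_bilinear :
  bilinear_for *:%R *:%R (anticommutator mu).
Proof.
split=> u a x y; rewrite /anticommutator /applyr linearP linearPl ?linearPr /=;
  by rewrite scalerDr addrACA.
Qed.

HB.instance Definition _ :=
  bilinear_isBilinear.Build K A A A *:%R *:%R (anticommutator mu)
    anticommutator_is_bilinear.

End AnticommutatorBilinear.

(* Main.v *)
Require Import Defs.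
From HB Require Import structures.
From mathcomp Require Import all_boot all_order all_algebra.

Set Implicit Arguments.
Unset Strict Implicit.
Unset Printing Implicit Defensive.

Import GRing.Theory.
Local Open Scope ring_scope.

(** Write [L(x)] for left multiplication by [x] and [x o y] for the
    anticommutator.  Read as identities between operators applied to [u], the
    two Hom-pre-Jordan identities are the last two axioms of a representation
    for [(A, L, alpha)]: the first ones coincide, and the second ones differ by
    exchanging [y] and [z] and by replacing the right-hand side with the other
    side of the first identity ([hom_pre_JordanP]).

    What remains is that Hom-pre-Jordan implies Hom-Jordan
    ([hom_pre_Jordan_Jordan]).  Expanding the outer product [o], the identity
    [((x o x) o alpha y) o alpha^2 x = alpha (x o x) o (alpha y o alpha x)]
    is the sum of
    - [alpha^2 x ((x o x) (alpha y)) = alpha (x o x) (alpha x alpha y)],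
      the diagonal [x = y = z] of the first pre-Jordan identity divided by 3,
      which is where the characteristic enters ([hom_pre_Jordan_diag]);
    - an identity obtained by putting [z = u = x] in both pre-Jordan
      identities and eliminating their common right-hand side
      ([hom_pre_Jordan_polar]). *)

Section HomPreJordan.

Variables (K : fieldType) (A : lmodType K).
Variables (mu : {bilinear A -> A -> A}) (alpha : {linear A -> A}).

Local Notation o := (anticommutator mu).

Lemma anticommutatorC x y : o x y = o y x.
Proof. exact: addrC. Qed.

Lemma anticommutatorxx x : o x x = mu x x *+ 2.
Proof. by rewrite mulr2n. Qed.

Lemma multiplicative_anticommutator :
  multiplicative_hom mu alpha ->
  forall x y, alpha (o x y) = o (alpha x) (alpha y).
Proof. by move=> alphaM x y; rewrite linearD /= !alphaM. Qed.

(** Linearity of [L] is bilinearity of [mu], and compatibility of [L] with the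
    twists is multiplicativity of [alpha]; the other two clauses match the
    pre-Jordan identities one by one. *)
Lemma hom_pre_JordanP :
  multiplicative_hom mu alpha ->
  is_hom_pre_Jordan mu alpha <->
  is_hom_Jordan_rep (anticommutator mu) alpha (left_mul mu) alpha.
Proof.
move=> alphaM; split=> [[pJ1 pJ2] | [_ _ rep1 rep2]]; split.
- by move=> a x y v; rewrite /left_mul /= linearPl.
- exact: alphaM.
- by move=> x y z v; rewrite /left_mul /= pJ1.
- move=> x y z v; rewrite /left_mul /= pJ1 pJ2.
  rewrite (anticommutatorC z y) (anticommutatorC y x) (anticommutatorC x z).
  by rewrite addrAC.
- by move=> x y z u; have:= rep1 x y z u; rewrite /left_mul /= => ->.
move=> x y z u; have:= rep1 x z y u; have:= rep2 x z y u.
rewrite /left_mul /= => -> <-.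
rewrite (anticommutatorC z y) (anticommutatorC y x) (anticommutatorC x z).
by rewrite addrAC.
Qed.

Hypothesis pJ : is_hom_pre_Jordan mu alpha.

Lemma hom_pre_Jordan_diag : (3%:R : K) != 0 -> forall x y,
  mu (alpha (alpha x)) (mu (o x x) (alpha y)) =
  mu (o (alpha x) (alpha x)) (mu (alpha x) (alpha y)).
Proof.
move=> nz3 x y; apply: (scalerI nz3); rewrite !scaler_nat !mulrS !mulr0n !addr0.
by rewrite !addrA; have [-> _] := pJ.
Qed.

(** At [z = u = x] the factors [2] produced by the symmetry in [x] and [z] are
    absorbed by [x o x = 2 (x x)]. *)
Lemma hom_pre_Jordan_polar x y :
  mu (o (o x x) (alpha y)) (alpha (alpha x))
  + mu (alpha (alpha x)) (mu (alpha y) (o x x)) =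
  mu (o (alpha y) (alpha x)) (o (alpha x) (alpha x))
  + mu (o (alpha x) (alpha x)) (mu (alpha y) (alpha x)).
Proof.
have [pJ1 pJ2] := pJ; have := pJ2 x y x x; rewrite -pJ1.
rewrite (anticommutatorC (alpha x) (alpha y)) -addrA -!mulr2n => pJx.
(* Only the [x o x] in right-hand factors must be expanded. *)
have mu_oxx a b : mu a (o b b) = mu a (mu b b) *+ 2.
  by rewrite anticommutatorxx linearMn.
have mu2_oxx a b c : mu a (mu b (o c c)) = mu a (mu b (mu c c)) *+ 2.
  by rewrite mu_oxx linearMn.
by rewrite mu2_oxx mu_oxx pJx.
Qed.

Lemma hom_pre_Jordan_Jordan :
  multiplicative_hom mu alpha -> (3%:R : K) != 0 ->
  is_hom_Jordan (anticommutator mu) alpha.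
Proof.
move=> alphaM nz3; split=> [|x y]; first exact: anticommutatorC.
apply/eqP; rewrite /hom_associator /= subr_eq0; apply/eqP.
rewrite (multiplicative_anticommutator alphaM).
transitivity (mu (o (o x x) (alpha y)) (alpha (alpha x))
    + mu (alpha (alpha x)) (mu (alpha y) (o x x))
    + mu (alpha (alpha x)) (mu (o x x) (alpha y))).
  by rewrite {1}/anticommutator [in X in _ + X]/(o (o x x) _) linearD addrAC addrA.
rewrite hom_pre_Jordan_polar hom_pre_Jordan_diag //.
rewrite [in RHS]/(o (o _ _) _) [X in _ = X + _]linearD.
by rewrite -addrA addrC.
Qed.

End HomPreJordan.

Theorem proposition2p2 (K : fieldType) (charK0 : [pchar K] =i pred0)
    (A : lmodType K) (mu : {bilinear A -> A -> A}) (alpha : {linear A -> A})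
    (alphaM : multiplicative_hom mu alpha) :
  is_hom_pre_Jordan mu alpha <->
  (is_hom_Jordan (anticommutator mu) alpha /\
   is_hom_Jordan_rep (anticommutator mu) alpha (left_mul mu) alpha).
Proof.
have nz3 : (3%:R : K) != 0 by rewrite (pcharf0P K).1.
split=> [pJ | [_ rep]]; last exact/hom_pre_JordanP.
by split; [exact: hom_pre_Jordan_Jordan | exact/hom_pre_JordanP].
Qed.
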